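(* Assume that (i) for every $j\in\{1,\dots,K\}$ and all $1\le \tau\le\tau'$, $\max_i p_{ji}^{(\tau)}\ge \max_i p_{ji}^{(\tau')}$, and (ii) $R^1<\infty$ and $R^1\ge R(\vec\pi_j^{\tau},0)\ge R(\vec\pi_j^{\tau'},0)$ for all $j$ and all $1\le\tau\le\tau'$. Let $W$ be fixed. Then there exist $\Gamma_1,\dots,\Gamma_K\in\{0,1,\ldots\}$ such that the threshold policy $\vec\Gamma=(\Gamma_1,\dots,\Gamma_K)$ is an optimal solution of the single-user long-run average problem: maximize over policies $\phi$ $$\liminf_{T\to\infty}\frac{1}{T}\,\mathbb{E}\Big(\sum_{t=1}^T\big(r(\vec b^\phi(t),a^\phi(t))+W(1-a^\phi(t))\big)\Big)$$ in the approximating controlled Markov chain described in the context.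
   Context: Single-user model. Let $P=(p_{ij})_{i,j\in\{1,\dots,K\}}$ be a stochastic matrix (transition matrix of the user's channel with states $h_1,\dots,h_K$), with $\tau$-step probabilities $p_{ij}^{(\tau)}=(P^\tau)_{ij}$ and steady-state distribution $(p_1^s,\dots,p_K^s)$ (assumed to exist). For $j\in\{1,\dots,K\}$ and integer $\tau\ge1$ the belief state $\vec\pi_j^\tau=\vec e_jP^\tau=(p_{j1}^{(\tau)},\dots,p_{jK}^{(\tau)})$, where $\vec e_j$ is the $j$-th unit row vector, means that the user was last observed $\tau$ slots ago in channel state $h_j$; belief states are labelled by the pairs $(j,\tau)$. In each slot an action $a\in\{0,1\}$ is chosen ($a=1$ active: a pilot is allocated; $a=0$ passive). The average immediate reward is $r(\vec\pi_j^\tau,1)=R^1$ and $r(\vec\pi_j^\tau,0)=R(\vec\pi_j^\tau,0)$; rewards are throughputs, so they are nonnegative. $W$ is the subsidy for passivity. Approximating transition law: under $a=0$, $\vec\pi_j^\tau$ moves to $\vec\pi_j^{\tau+1}$ with probability 1; under $a=1$, $\vec\pi_j^\tau$ moves to $\vec\pi_k^1$ with probability $p_k^s$, $k=1,\dots,K$. $\vec b^\phi(t)$ and $a^\phi(t)$ denote belief state and action at slot $t$ under policy $\phi$. Threshold policy $\vec\Gamma=(\Gamma_1,\dots,\Gamma_K)$: choose $a=0$ in $\vec\pi_j^\tau$ if $\tau\le\Gamma_j$ and $a=1$ if $\tau>\Gamma_j$.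
   Formalization: Thresholds Γ_j may be +∞ (never active in row j), but only if R^1 < W + R(π_j^τ,0) for all τ ≥ 1; with finite Γ_j only the claim fails: K=1, R^1=1, R=0, W=5, where always passive earns 5 and any finite threshold less. *)

(* Defs.v *)
(* MathComp / MathComp-Analysis *)
From mathcomp Require Import all_boot all_order all_algebra.
From mathcomp Require Import all_classical all_reals all_analysis.

Set Implicit Arguments.
Unset Strict Implicit.
Unset Printing Implicit Defensive.
Import Order.TTheory GRing.Theory Num.Theory.
Local Open Scope classical_set_scope.
Local Open Scope ring_scope.

Section Chain.
Variables (R : realType) (K : nat).

Definition stochastic (P : 'M[R]_K) : Prop :=
  (forall i j, 0 <= P i j) /\ (forall i, \sum_j P i j = 1).

(* Stationarity is all that is required of the steady state, so a limiting
   distribution lim_tau (P ^+ tau) j _ is covered. *)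
Definition steady_state (P : 'M[R]_K) (ps : 'rV[R]_K) : Prop :=
  [/\ forall k, 0 <= ps 0 k, \sum_k ps 0 k = 1 & ps *m P = ps].

Definition belief (P : 'M[R]_K) (j : 'I_K) (tau : nat) : 'rV[R]_K :=
  delta_mx 0 j *m (P ^+ tau).

(* The entries of P ^+ tau are nonnegative, so 0 is a neutral start value. *)
Definition max_prob (P : 'M[R]_K) (j : 'I_K) (tau : nat) : R :=
  \big[Num.max/0]_(i < K) (P ^+ tau) j i.

End Chain.

(* (j, tau) is the label of the belief state e_j P^tau.  Only the labels with
   1 <= tau are belief states of the model; they are closed under [trans]. *)
Notation bstate K := ('I_K * nat)%type.

Section Control.
Variables (R : realType) (K : nat).

(* A past is the chronological list of the (belief state, action) pairs of the
   previous slots; the action true is the active one. *)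
Definition past : Type := seq (bstate K * bool).

(* History-dependent randomized policies: [active h s] is the probability of
   choosing the active action in s after the past h. *)
Record policy := Policy {
  active :> past -> bstate K -> R;
  active01 : forall h s, 0 <= active h s <= 1 }.

Definition act_prob (phi : policy) (h : past) (s : bstate K) (a : bool) : R :=
  if a then phi h s else 1 - phi h s.

Definition trans (ps : 'rV[R]_K) (s : bstate K) (a : bool) (s' : bstate K) : R :=
  if a then (if s'.2 == 1%N then ps 0 s'.1 else 0)
  else (s' == (s.1, s.2.+1))%:R.

Lemma trans_finite_support ps s a : finite_set [set s' | trans ps s a s' != 0].
Proof.
case: a; last first.
  apply: (sub_finite_set _ (finite_set1 (s.1, s.2.+1))) => s' /=.
  by rewrite pnatr_eq0 eqb0 negbK => /eqP.
apply: (sub_finite_set _ (finite_image (fun k : 'I_K => (k, 1%N))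
  (@finite_finset _ setT))) => -[k t] /=.
by rewrite /trans /=; case: (t =P 1%N) => [->|_]; [exists k | rewrite eqxx].
Qed.

(* Probability that the coming slots produce exactly the (state, action) pairs
   listed in w, when h is the past and mu is the law of the next state. *)
Fixpoint path_prob (ps : 'rV[R]_K) (phi : policy) (mu : bstate K -> R)
    (h : past) (w : seq (bstate K * bool)) : R :=
  if w is (s, a) :: w' then
    mu s * act_prob phi h s a *
    path_prob ps phi (trans ps s a) (rcons h (s, a)) w'
  else 1.

Lemma path_prob_finite_support ps phi mu h n :
  finite_set [set s | mu s != 0] ->
  finite_set [set w : n.-tuple (bstate K * bool)
             | path_prob ps phi mu h w != 0].
Proof.
elim: n mu h => [|n IHn] mu h mu_fin.
  by apply: (sub_finite_set _ (finite_set1 [tuple])) => w _; exact: tuple0.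
pose A := [set sa : bstate K * bool | mu sa.1 != 0].
have A_fin : finite_set A.
  apply: (sub_finite_set _ (finite_setX mu_fin (@finite_finset _ setT))).
  by move=> [s a].
pose B (sa : bstate K * bool) := [set cons_tuple sa w | w in
  [set w : n.-tuple _ | path_prob ps phi (trans ps sa.1 sa.2) (rcons h sa) w != 0]].
apply: (sub_finite_set (B := \bigcup_(sa in A) B sa)).
  case/tupleP=> -[s a] w /=; rewrite !mulf_eq0 !negb_or => /andP[/andP[mu0 _] w0].
  by exists (s, a) => //; exists w.
apply: bigcup_finite => // -[s a] _; apply/finite_image/IHn.
exact: trans_finite_support.
Qed.

(* E(f(b(1), a(1), ..., b(T), a(T))) for the chain started in s0.  The sum has
   finite support by [path_prob_finite_support]. *)
Definition expect (ps : 'rV[R]_K) (phi : policy) (s0 : bstate K) (T : nat)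
    (f : seq (bstate K * bool) -> R) : R :=
  \sum_(w \in [set: T.-tuple (bstate K * bool)])
    path_prob ps phi (fun s => (s == s0)%:R) [::] w * f w.

Definition reward (P : 'M[R]_K) (R1 : R) (R0 : 'rV[R]_K -> R)
    (s : bstate K) (a : bool) : R :=
  if a then R1 else R0 (belief P s.1 s.2).

Definition total_reward P R1 R0 (W : R) (w : seq (bstate K * bool)) : R :=
  \sum_(sa <- w) (reward P R1 R0 sa.1 sa.2 + W * (1 - (sa.2 : nat)%:R)).

Definition gain P ps R1 R0 W (phi : policy) (s0 : bstate K) : \bar R :=
  limn_einf (fun T : nat =>
    (T%:R^-1 * expect ps phi s0 T (total_reward P R1 R0 W))%:E).

(* Optimality among all policies, from every initial belief state. *)
Definition optimal P ps R1 R0 W (phi : policy) : Prop :=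
  forall (psi : policy) (s0 : bstate K), (1 <= s0.2)%N ->
    (gain P ps R1 R0 W psi s0 <= gain P ps R1 R0 W phi s0)%E.

(* Gamma j = None is the threshold +oo (never active after observing j).  It
   cannot be dispensed with when W is large: for K = 1, R1 = 1, R0 = 0 and
   W > 1, never being active earns W per slot, whereas the finite threshold g
   earns (g * W + 1) / (g + 1) < W. *)
Definition threshold_active (Gamma : 'I_K -> option nat) (s : bstate K) : bool :=
  if Gamma s.1 is Some g then (g < s.2)%N else false.

Lemma threshold_active01 Gamma (h : past) (s : bstate K) :
  0 <= ((threshold_active Gamma s : nat)%:R : R) <= 1.
Proof. by case: threshold_active; rewrite ?lexx ler01. Qed.

Definition threshold_policy (Gamma : 'I_K -> option nat) : policy :=
  Policy (threshold_active01 Gamma).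

End Control.

(* Main.v *)
Require Import Defs.
From mathcomp Require Import all_boot all_order all_algebra.
From mathcomp Require Import all_classical all_reals all_analysis.
From mathcomp Require Import ring lra.
Import Order.TTheory GRing.Theory Num.Theory.
Local Open Scope ring_scope.

(** Call the belief states (j, 1), (j, 2), ... row j, and write
    f_j(n) = W + R0(pi_j^(n+1)) for the reward of a passive slot in (j, n + 1);
    it is nonincreasing in n.  An active slot
    earns R1 and restarts the chain in (k, 1) with probability ps_k, whatever
    the state it is taken in.

    Charge c per slot.  The net value of one renewal cycle whose passive phase
    is stopped optimally among the first N passive slots is
      F_N(c) = R1 - c + sum_k ps_k sum_(i < N) (f_k(i) - c)^+
    ([surplus]), because, f_k being nonincreasing, the best moment to stop is
    when f_k falls below c.  The critical charge G is the least c such that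
    F_N(c) <= 0 for all N ([critical_level_exists]); it is the optimal long-run
    average from the restart distribution.

    Upper bound.  G n + sum_(m <= i < m + n) (f_j(i) - G)^+ is a supersolution
    of the n-step dynamic programming equation in state (j, m+1), because
    F_n(G) <= 0; hence it bounds the n-step reward of every policy
    ([value_upper_bound]).  If f_j(n) <= G for some n, the sum stays bounded and
    the average is at most G; if f_j >= G throughout, staying passive forever
    attains the bound exactly ([value_never_active]).

    Lower bound.  It remains to find a set of passive states under which the
    average is at least G from everywhere; a potential bounded above certifies
    this ([value_lower_bound]).  There are two cases.
    - F_N(G) = 0 for some N.  Being passive exactly where f > G works, with the
      remaining sum of (f - G)^+ as potential: optimal cycles break even
      ([optimal_threshold_balanced]).
    - F_N(G) < 0 for all N.  Then some k with ps_k > 0 has f_k >= G forever,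
      since otherwise only finitely many slots would matter and the charge
      could be lowered ([critical_level_slack]).  Being passive exactly where
      f >= G works: each restart enters such an absorbing row with probability
      at least ps_k, so the loss with respect to G is bounded
      ([optimal_threshold_absorbing]).
    In both cases the passive states of a row form an initial segment, i.e. the
    policy is a threshold policy, and an infinite threshold in row j means
    f_j > G >= R1 throughout, respectively f_j >= G > R1. *)

(** * Expected rewards by first-step analysis *)

Section Tower.
Local Open Scope classical_set_scope.
Context {R : realType} {K : nat} (ps : 'rV[R]_K).

Definition next_mean (s : bstate K) (a : bool) (g : bstate K -> R) : R :=
  if a then \sum_k ps 0 k * g (k, 1%N) else g (s.1, s.2.+1).

Lemma sum_trans s a g :
  \sum_(s' \in [set: bstate K]) trans ps s a s' * g s' = next_mean s a g.
Proof.
case: a => /=; last first.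
  rewrite -(@fsbig_widen _ _ _ _ [set (s.1, s.2.+1)]) //; last first.
    by move=> s' [_ /= /eqP/negPf->]; rewrite mul0r.
  by rewrite fsbig_set1 eqxx mul1r.
rewrite -(@fsbig_widen _ _ _ _ ((fun k : 'I_K => (k, 1%N)) @` setT)) //; last first.
  move=> [k t] [_ /= kt]; rewrite /trans /=; case: eqP => [t1|_]; last by rewrite mul0r.
  by case: kt; exists k => //; rewrite t1.
rewrite fsbig_image; last by move=> k l _ _ [].
rewrite (fsbigE (index_enum 'I_K)) ?index_enum_uniq //; last first.
  by move=> i _; rewrite mem_index_enum.
by apply: eq_big => [k|k _]; rewrite ?in_setT // /trans /=.
Qed.

Variable phi : policy R K.

(** Conditional expectation of F over the next n slots, given the past h and the
    current state s: the tower property turned into a recursion, so that no sum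
    over trajectories is left. *)
Fixpoint mean (n : nat) (h : past K) (s : bstate K)
    (F : seq (bstate K * bool) -> R) : R :=
  if n is n'.+1 then
    \sum_(a : bool) act_prob phi h s a *
      next_mean s a (fun s' => mean n' (rcons h (s, a)) s' (fun w => F ((s, a) :: w)))
  else F [::].

(** The sums over states and trajectories have finite support but infinite
    range, so both are first restricted to finite sets A and C that contain the
    supports; only then may they be exchanged. *)
Lemma sum_first_step n (mu : bstate K -> R) h (F : seq (bstate K * bool) -> R) :
  finite_set [set s | mu s != 0] ->
  \sum_(w \in [set: n.+1.-tuple (bstate K * bool)]) path_prob ps phi mu h w * F w =
  \sum_(s \in [set: bstate K]) mu s * \sum_(a : bool) act_prob phi h s a *
    \sum_(w \in [set: n.-tuple (bstate K * bool)])
       path_prob ps phi (trans ps s a) (rcons h (s, a)) w * F ((s, a) :: w).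
Proof.
set A := [set s | mu s != 0] => finA.
pose supp (sa : bstate K * bool) := [set w : n.-tuple (bstate K * bool) |
  path_prob ps phi (trans ps sa.1 sa.2) (rcons h sa) w != 0].
pose B := A `*` [set: bool]; pose C := \bigcup_(sa in B) supp sa.
have finB : finite_set B by apply: finite_setX => //; exact: finite_finset.
have finC : finite_set C.
  apply: bigcup_finite => // -[s a] _; apply: path_prob_finite_support.
  exact: trans_finite_support.
pose cons_pair (p : (bstate K * bool) * n.-tuple (bstate K * bool)) :=
  cons_tuple p.1 p.2.
have cons_bij : bijective cons_pair.
  exists (fun w => (thead w, behead_tuple w)).
    by move=> [sa w] /=; congr pair; apply: val_inj.
  by move=> w; rewrite [RHS]tuple_eta.
rewrite (reindex_fsbigT cons_pair) //.
rewrite -(@fsbig_widen _ _ _ _ (B `*` C)) //; last first.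
  move=> [[s a] w] [_ /= /not_andP[nB|nC]].
    have -> : mu s = 0 by apply/eqP/negP => mu0; apply: nB; split => //; exact/negP.
    by rewrite !mul0r.
  have [->|mu0] := eqVneq (mu s) 0; first by rewrite !mul0r.
  have [->|w0] := eqVneq (path_prob ps phi (trans ps s a) (rcons h (s, a)) w) 0.
    by rewrite mulr0 mul0r.
  by case: nC; exists (s, a).
rewrite -(@pair_fsbig _ _ _ _ _ B C (fun sa (w : n.-tuple _) =>
  path_prob ps phi mu h (sa :: w) * F (sa :: w))) //.
transitivity (\sum_(sa \in B) mu sa.1 * (act_prob phi h sa.1 sa.2 *
    \sum_(w \in [set: n.-tuple (bstate K * bool)])
       path_prob ps phi (trans ps sa.1 sa.2) (rcons h (sa.1, sa.2)) w *
       F ((sa.1, sa.2) :: w))).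
  apply: eq_fsbigr => -[s a]; rewrite inE => Bsa /=.
  under eq_fsbigr do rewrite -!mulrA.
  rewrite -!mulr_fsumr; congr (_ * (_ * _)); apply: fsbig_widen => // w [_ nC] /=.
  apply/eqP; rewrite mulf_eq0; apply/orP; left; apply: contrapT => /negP w0.
  by apply: nC; exists (s, a).
rewrite -(@pair_fsbig _ _ _ _ _ A setT (fun s a => mu s * (act_prob phi h s a *
    \sum_(w \in [set: n.-tuple (bstate K * bool)])
       path_prob ps phi (trans ps s a) (rcons h (s, a)) w * F ((s, a) :: w)))) //;
  last exact: finite_finset.
rewrite -[RHS](@fsbig_widen _ _ _ _ A) //; last first.
  move=> s [_ nA] /=; have -> : mu s = 0 by apply/eqP/negP => /negP.
  by rewrite mul0r.
apply: eq_fsbigr => s _; rewrite -mulr_fsumr; congr (_ * _).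
rewrite (fsbigE (index_enum bool)) ?index_enum_uniq //; last first.
  by move=> i _; rewrite mem_index_enum.
by apply: eq_bigl => a; rewrite in_setT.
Qed.

Lemma sum_path_prob n (mu : bstate K -> R) h
    (F : seq (bstate K * bool) -> R) : \sum_k ps 0 k = 1 ->
  finite_set [set s | mu s != 0] -> \sum_(s \in [set: bstate K]) mu s = 1 ->
  \sum_(w \in [set: n.-tuple (bstate K * bool)]) path_prob ps phi mu h w * F w =
  \sum_(s \in [set: bstate K]) mu s * mean n h s F.
Proof.
move=> ps1; elim: n mu h F => [|n IHn] mu h F mu_fin mu1.
  rewrite /= -mulr_fsuml mu1 mul1r.
  rewrite -(@fsbig_widen _ _ _ _ [set [tuple]]) //.
    by rewrite fsbig_set1 /= mul1r.
  by move=> w [_]; case; rewrite /= tuple0.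
rewrite sum_first_step //; apply: eq_fsbigr => s _; congr (_ * _).
apply: eq_bigr => a _; congr (_ * _).
rewrite (IHn _ _ (fun w => F ((s, a) :: w))) ?sum_trans //.
  exact: trans_finite_support.
under eq_fsbigr do rewrite -[trans _ _ _ _]mulr1.
rewrite (sum_trans s a (fun=> 1)) /next_mean; case: a => //.
by under eq_bigr do rewrite mulr1.
Qed.

Lemma expectE s T (F : seq (bstate K * bool) -> R) : \sum_k ps 0 k = 1 ->
  expect ps phi s T F = mean T [::] s F.
Proof.
move=> ps1.
have dirac_sum g : \sum_(s' \in [set: bstate K]) (s' == s)%:R * g s' = g s :> R.
  rewrite -(@fsbig_widen _ _ _ _ [set s]) //; last first.
    by move=> s' [_ /= /eqP/negPf->]; rewrite mul0r.
  by rewrite fsbig_set1 eqxx mul1r.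
rewrite /expect sum_path_prob //.
  apply: (sub_finite_set _ (finite_set1 s)) => s' /=.
  by rewrite pnatr_eq0 eqb0 negbK => /eqP.
under eq_fsbigr do rewrite -[_%:R]mulr1.
exact: (dirac_sum (fun=> 1)).
Qed.

Lemma next_mean_addl s a c g : \sum_k ps 0 k = 1 ->
  next_mean s a (fun s' => c + g s') = c + next_mean s a g.
Proof.
move=> ps1; case: a => //=; under eq_bigr do rewrite mulrDr.
by rewrite big_split /= -mulr_suml ps1 mul1r.
Qed.

Lemma next_mean_le s a g1 g2 : (forall k, 0 <= ps 0 k) ->
  (forall s', (0 < s'.2)%N -> g1 s' <= g2 s') -> next_mean s a g1 <= next_mean s a g2.
Proof.
move=> ps_ge0 le_g; case: a => /=; last exact: le_g.
by apply: ler_sum => k _; apply: ler_wpM2l => //; exact: le_g.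
Qed.

Lemma sum_act_prob h s : \sum_(a : bool) act_prob phi h s a = 1.
Proof. by rewrite big_bool /= addrC subrK. Qed.

Lemma mean_addl n h s c F : \sum_k ps 0 k = 1 ->
  mean n h s (fun w => c + F w) = c + mean n h s F.
Proof.
move=> ps1; elim: n h s F => [//|n IHn] h s F /=.
under eq_bigr => a _.
  under (eq_fun (_ : forall s', _ = _)) do rewrite IHn.
  rewrite next_mean_addl // mulrDr.
  over.
by rewrite big_split /= -mulr_suml sum_act_prob mul1r.
Qed.

Variable rho : bstate K -> bool -> R.

Definition value n h s : R :=
  mean n h s (fun w => \sum_(sa <- w) rho sa.1 sa.2).

Lemma value0 h s : value 0 h s = 0.
Proof. by rewrite /value /= big_nil. Qed.

Lemma valueS n h s : \sum_k ps 0 k = 1 -> value n.+1 h s =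
  \sum_(a : bool) act_prob phi h s a *
    (rho s a + next_mean s a (value n (rcons h (s, a)))).
Proof.
move=> ps1; apply: eq_bigr => a _; congr (_ * _).
rewrite -next_mean_addl //; congr (next_mean s a _); apply/funext => s'.
rewrite -mean_addl //; congr mean; apply/funext => w.
by rewrite big_cons.
Qed.

(** Verification principle: a supersolution of the finite-horizon optimality
    equation dominates every policy, since a randomized action averages the
    right-hand sides of the two actions. *)
Lemma value_le (v : nat -> bstate K -> R) :
  (forall k, 0 <= ps 0 k) -> \sum_k ps 0 k = 1 ->
  (forall s, 0 <= v 0%N s) ->
  (forall n s a, (0 < s.2)%N -> rho s a + next_mean s a (v n) <= v n.+1 s) ->
  forall n h s, (0 < s.2)%N -> value n h s <= v n s.
Proof.
move=> ps_ge0 ps1 v0 vS; elim=> [|n IHn] h s s_gt0; first by rewrite value0.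
have -> : v n.+1 s = \sum_(a : bool) act_prob phi h s a * v n.+1 s.
  by rewrite -mulr_suml sum_act_prob mul1r.
rewrite valueS //; apply: ler_sum => a _; apply: ler_wpM2l.
  by case: a => /=; have /andP[] := active01 phi h s; rewrite ?subr_ge0.
apply: le_trans (vS n s a s_gt0); rewrite lerD2l.
by apply: next_mean_le => // s' ?; apply: IHn.
Qed.

Lemma valueS_deterministic (act : bstate K -> bool) n h s :
  \sum_k ps 0 k = 1 -> (phi h s = (act s : nat)%:R) ->
  value n.+1 h s =
  rho s (act s) + next_mean s (act s) (value n (rcons h (s, act s))).
Proof.
move=> ps1 phiE; rewrite valueS // big_bool /= phiE.
by case: (act s); rewrite /= ?subrr ?subr0 !(mul1r, mul0r) ?addr0 ?add0r.
Qed.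

(** Dually, a stationary deterministic policy earns at least any subsolution of
    its own evaluation equation. *)
Lemma value_ge (act : bstate K -> bool) (v : nat -> bstate K -> R) :
  (forall k, 0 <= ps 0 k) -> \sum_k ps 0 k = 1 ->
  (forall h s, phi h s = (act s : nat)%:R) ->
  (forall s, v 0%N s <= 0) ->
  (forall n s, (0 < s.2)%N ->
     v n.+1 s <= rho s (act s) + next_mean s (act s) (v n)) ->
  forall n h s, (0 < s.2)%N -> v n s <= value n h s.
Proof.
move=> ps_ge0 ps1 phiE v0 vS; elim=> [|n IHn] h s s_gt0; first by rewrite value0.
rewrite (valueS_deterministic act) //; apply: (le_trans (vS _ _ s_gt0)).
by rewrite lerD2l; apply: next_mean_le => // s' ?; apply: IHn.
Qed.

End Tower.

(** * The critical charge per slot *)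

Section Critical.
Local Open Scope classical_set_scope.
Context {R : realType} {K : nat} (p : 'I_K -> R) (f : 'I_K -> nat -> R) (R1 : R).
Hypothesis p_ge0 : forall k, 0 <= p k.
Hypothesis p_sum : \sum_k p k = 1.
Hypothesis f_nonincr : forall j m n, (m <= n)%N -> f j n <= f j m.

(** The gain, over the charge c, of the passive slots m, ..., n - 1 of row j when
    the unprofitable ones are skipped. *)
Definition excess (c : R) (j : 'I_K) (m n : nat) : R :=
  \sum_(m <= i < n) Num.max (f j i - c) 0.

(** Expected gain, over the charge c, of a restart cycle with at most N passive
    slots that is stopped optimally. *)
Definition surplus (N : nat) (c : R) : R :=
  R1 - c + \sum_k p k * excess c k 0 N.

Lemma surplus0 c : surplus 0 c = R1 - c.
Proof.
by rewrite /surplus big1 ?addr0 // => k _; rewrite /excess big_geq ?mulr0.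
Qed.

Lemma excess_ge0 c j m n : 0 <= excess c j m n.
Proof. by apply: sumr_ge0 => i _; rewrite le_max lexx orbT. Qed.

Lemma excess_recl c j m n : (m < n)%N ->
  excess c j m n = Num.max (f j m - c) 0 + excess c j m.+1 n.
Proof. exact: big_ltn. Qed.

Lemma excess_eq0 c j m n : f j m <= c -> excess c j m n = 0.
Proof.
move=> fc; rewrite /excess big_nat_cond big1 // => i /andP[/andP[mi _] _].
by apply/max_idPr; rewrite subr_le0 (le_trans (f_nonincr _ _ _ mi)).
Qed.

Lemma excess_cat c j m n q : (m <= n)%N -> (n <= q)%N ->
  excess c j m q = excess c j m n + excess c j n q.
Proof. exact: big_cat_nat. Qed.

(** A cycle counted by [surplus N] has at most N + 1 slots, so lowering the charge
    by d - c raises its gain by at most N + 1 times that much. *)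
Lemma surplus_Lipschitz N c d : c <= d ->
  surplus N c <= surplus N d + N.+1%:R * (d - c).
Proof.
move=> cd; rewrite /surplus.
have le_excess k : excess c k 0 N <= excess d k 0 N + N%:R * (d - c).
  have -> : N%:R * (d - c) = \sum_(0 <= i < N) (d - c).
    by rewrite sumr_const_nat subn0 mulr_natl.
  rewrite -big_split /=; apply: ler_sum => i _.
  by rewrite ge_max; case: (leP (f k i - d) 0) => ?; apply/andP; split; lra.
have : \sum_k p k * excess c k 0 N <=
       \sum_k p k * excess d k 0 N + N%:R * (d - c).
  have -> : N%:R * (d - c) = \sum_k p k * (N%:R * (d - c)).
    by rewrite -mulr_suml p_sum mul1r.
  rewrite -big_split /=.
  by apply: ler_sum => k _; rewrite -mulrDr ler_wpM2l.
rewrite -[N.+1%:R]natr1; lra.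
Qed.

(** Rewards are nonincreasing, so a row that has become unprofitable by slot N stays
    so, and lengthening the passive phase beyond N gains nothing. *)
Lemma surplus_le_stable M N c : (forall k, 0 < p k -> f k N <= c) ->
  surplus M c <= surplus N c.
Proof.
move=> fc; rewrite lerD2l; apply: ler_sum => k _.
have := p_ge0 k; rewrite le0r => /predU1P[->|p_gt0]; first by rewrite !mul0r.
rewrite ler_wpM2l ?p_ge0 //.
have [NM|/ltnW MN] := leqP N M.
  by rewrite (excess_cat _ _ _ _ _ _ NM) // (excess_eq0 _ _ N) ?addr0 // fc.
by rewrite (excess_cat _ _ _ _ _ _ MN) // lerDl excess_ge0.
Qed.

(** The charges c with F_N(c) <= 0 for all N are bounded below by R1, as the case
    N = 0 shows, and the Lipschitz bound passes the condition to their infimum. *)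
Lemma critical_level_exists : exists G,
  (forall N, surplus N G <= 0) /\
  (forall c, (forall N, surplus N c <= 0) -> G <= c).
Proof.
pose S : set R := [set c | forall N, surplus N c <= 0].
have S_lb : lbound S R1.
  by move=> c /(_ 0%N); rewrite surplus0; lra.
have S_inf : has_inf S.
  split; last by exists R1.
  exists (\big[Num.max/R1]_k f k 0%N) => N.
  apply: (le_trans (surplus_le_stable N 0 _ _)) => [k _|]; first exact: le_bigmax.
  by rewrite surplus0 subr_le0 bigmax_idl le_max lexx.
exists (inf S); split=> [N|c Sc]; last by apply: ge_inf => //; case: S_inf.
rewrite leNgt; apply/negP => pos.
have step : 0 < surplus N (inf S) / N.+1%:R by rewrite divr_gt0.
have [c Sc] := inf_adherent step S_inf.
have le_c : inf S <= c by apply: ge_inf => //; case: S_inf.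
rewrite -ltrBlDl ltr_pdivlMr // mulrC => small.
have := surplus_Lipschitz N _ _ le_c; have := Sc N; lra.
Qed.

(** If every row of positive probability fell below G, they would all do so within
    some N slots, and be below any charge c slightly less than G from then on.
    Then F_M(c) <= F_N(c) for all M, and F_N(c) <= 0 by continuity since
    F_N(G) < 0, contradicting the minimality of G. *)
Lemma critical_level_slack G :
  (forall N, surplus N G < 0) ->
  (forall c, (forall N, surplus N c <= 0) -> G <= c) ->
  exists2 k, 0 < p k & forall n, G <= f k n.
Proof.
move=> neg leG; apply: contrapT => nok.
have drop k : exists n, 0 < p k -> f k n < G.
  have [p_gt0|_] := boolP (0 < p k); last by exists 0%N.
  apply: contrapT => /forallNP nodrop; apply: nok; exists k => // n.
  by rewrite leNgt; apply/negP => fG; apply: (nodrop n).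
have [n dropn] := choice drop.
pose N := \max_k n k.
have fN k : 0 < p k -> f k N < G.
  move=> p_gt0; apply: le_lt_trans (dropn k p_gt0).
  by apply: f_nonincr; exact: leq_bigmax.
(* The first bound keeps c above the rewards at time N, the second keeps F_N(c)
   nonpositive. *)
pose c := Num.max (\big[Num.max/R1]_(k | 0 < p k) f k N) (G + surplus N G / N.+1%:R).
have cG : c < G.
  rewrite gt_max; apply/andP; split.
    apply: bigmax_lt => //; have := neg 0%N.
    by rewrite surplus0; lra.
  by rewrite gtrDl pmulr_llt0 // invr_gt0.
suff : G <= c by rewrite leNgt cG.
apply: leG => M; apply: (le_trans (surplus_le_stable M N _ _)).
  by move=> k p_gt0; rewrite le_max le_bigmax_cond.
have := surplus_Lipschitz N _ _ (ltW cG).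
have : G + surplus N G / N.+1%:R <= c by rewrite le_max lexx orbT.
rewrite -lerBrDl ler_pdivrMr //; lra.
Qed.

End Critical.

(** * Limits of averages *)

Section Limits.
Local Open Scope classical_set_scope.
Import numFieldNormedType.Exports.
Context {R : realType}.

Lemma le_limn_einf (u v : (\bar R)^nat) :
  (forall n, (u n <= v n)%E) -> (limn_einf u <= limn_einf v)%E.
Proof.
move=> le_uv; rewrite !limn_einf_lim.
apply: lee_lim; [exact: is_cvg_einfs|exact: is_cvg_einfs|].
apply: nearW => n; apply: le_ereal_inf_tmp => _ [m /= nm] <-.
by apply: le_trans (le_uv m); apply: ereal_inf_lbound; exists m.
Qed.

Lemma limn_einf_affine_average (G C : R) :
  limn_einf (fun T => (T%:R^-1 * (G * T%:R + C))%:E) = G%:E.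
Proof.
suff /cvg_limn_einf_sup[] : (fun T => (T%:R^-1 * (G * T%:R + C))%:E) @ \oo --> G%:E.
  by [].
apply: cvg_EFin; first exact: nearW.
rewrite -(cvg_shiftS (fun T => T%:R^-1 * (G * T%:R + C))).
have -> : (fun n => n.+1%:R^-1 * (G * n.+1%:R + C)) = (fun n => G + C * harmonic n).
  by apply/funext => n; rewrite mulrDr mulrCA mulVf ?pnatr_eq0 // mulr1 [_ * C]mulrC.
have : (fun n => G + C * harmonic n) @ \oo --> G + C * 0.
  by apply: cvgD; [exact: cvg_cst|apply: cvgMr; exact: cvg_harmonic].
by rewrite mulr0 addr0.
Qed.

End Limits.

(** * Optimality of threshold policies *)

Lemma threshold_of_passive_set (K : nat) (pass : 'I_K -> nat -> bool) :
  (forall j m n, (m <= n)%N -> pass j n -> pass j m) ->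
  exists Gamma : 'I_K -> option nat,
    (forall j m, threshold_active Gamma (j, m.+1) = ~~ pass j m) /\
    (forall j, Gamma j = None -> forall m, pass j m).
Proof.
move=> pass_down.
have level j : exists g : option nat,
    (forall m, (if g is Some g' then (g' < m.+1)%N else false) = ~~ pass j m).
  have [stop|nostop] := pselect (exists n, ~~ pass j n); last first.
    by exists None => m; apply/esym/negbTE/negP => nm; apply: nostop; exists m.
  exists (Some (ex_minn stop)) => m; case: ex_minnP => g ng gmin.
  apply/idP/idP => [|/gmin //]; rewrite ltnS => gm.
  by apply: contra ng; exact: pass_down.
have [Gamma GammaE] := choice level.
exists Gamma; split=> [j m|j Gj m]; first exact: GammaE.
by move: (GammaE j m); rewrite Gj => /esym/negbT; rewrite negbK.
Qed.

Section Optimality.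
Context {R : realType} {K : nat} (P : 'M[R]_K) (ps : 'rV[R]_K).
Context (R1 : R) (R0 : 'rV[R]_K -> R) (W : R).

(** Shifted by one, because the belief states of a row are numbered from 1. *)
Definition passive_reward (j : 'I_K) (n : nat) : R := W + R0 (belief P j n.+1).

Let f := passive_reward.
Let rho (s : bstate K) (a : bool) : R :=
  reward P R1 R0 s a + W * (1 - (a : nat)%:R).

Let rho_passive j n : rho (j, n.+1) false = f j n.
Proof. by rewrite /rho /= subr0 mulr1 addrC. Qed.

Let rho_active s : rho s true = R1.
Proof. by rewrite /rho /= subrr mulr0 addr0. Qed.

Hypothesis ps_ge0 : forall k, 0 <= ps 0 k.
Hypothesis ps_sum : \sum_k ps 0 k = 1.
Hypothesis f_nonincr : forall j m n, (m <= n)%N -> f j n <= f j m.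

Lemma gainE phi s : gain P ps R1 R0 W phi s =
  limn_einf (fun T => (T%:R^-1 * value ps phi rho T [::] s)%:E).
Proof.
by congr limn_einf; apply/funext => T; rewrite expectE.
Qed.

(** The bound is a supersolution for every policy: an active slot restarts with
    expected potential F_n(G) + G - R1 <= G - R1, and a passive slot uses up the
    first summand of the potential. *)
Lemma value_upper_bound G : (forall N, surplus (ps 0) f R1 N G <= 0) ->
  forall phi T h j m,
    value ps phi rho T h (j, m.+1) <= G * T%:R + excess f G j m (m + T).
Proof.
move=> surplus_le0 phi T h j m.
pose v (n : nat) (s : bstate K) := G * n%:R + excess f G s.1 s.2.-1 (s.2.-1 + n).
apply: (value_le ps phi rho v) => // [s|n [i [//|t]] a _].
  by rewrite /v /excess mulr0 add0r addn0 big_geq.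
rewrite /v -natr1 mulrDr mulr1 /=; case: a; rewrite /next_mean /=.
  under eq_bigr do rewrite mulrDr add0n.
  rewrite big_split /= -mulr_suml ps_sum mul1r rho_active.
  have := surplus_le0 n; have := excess_ge0 f G i t (t + n.+1).
  rewrite /surplus; lra.
rewrite rho_passive addnS addSn (excess_recl f G i t) ?ltnS ?leq_addr //.
by have : f i t - G <= Num.max (f i t - G) 0 by [rewrite le_max lexx]; lra.
Qed.

Section Threshold.
Context (G : R) (pass : 'I_K -> nat -> bool) (Gamma : 'I_K -> option nat).
Hypothesis GammaE : forall j m, threshold_active Gamma (j, m.+1) = ~~ pass j m.
Hypothesis pass_ge : forall j m, pass j m -> G <= f j m.
Hypothesis pass_le : forall j m, ~~ pass j m -> f j m <= G.

(** The hypotheses on w are the Poisson inequality with gain G along the policy.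
    Subtracting the bound B makes the potential nonpositive at horizon 0. *)
Lemma value_lower_bound (w : 'I_K -> nat -> R) (B : R) :
  (forall j m, w j m <= B) ->
  (forall j m, pass j m -> G + w j m <= f j m + w j m.+1) ->
  (forall j m, ~~ pass j m -> G + w j m <= R1 + \sum_k ps 0 k * w k 0%N) ->
  forall T h j m,
    G * T%:R + (w j m - B) <=
    value ps (threshold_policy R Gamma) rho T h (j, m.+1).
Proof.
move=> w_le w_pass w_act T h j m.
pose v (n : nat) (s : bstate K) := G * n%:R + (w s.1 s.2.-1 - B).
rewrite -[leLHS]/(v T (j, m.+1)).
apply: (value_ge ps (threshold_policy R Gamma) rho (threshold_active Gamma) v) => //.
  by move=> s; rewrite /v mulr0 add0r subr_le0.
move=> n [i [//|t]] _; rewrite /v GammaE -natr1 mulrDr mulr1 /=.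
have [it|it] /= := boolP (pass i t); rewrite /next_mean.
  by rewrite rho_passive /=; have := w_pass i t it; lra.
rewrite rho_active /=.
under eq_bigr do rewrite addrCA mulrDr.
under eq_bigr do rewrite [ps _ _ * (G * _ - _)]mulrC.
rewrite big_split /= -mulr_sumr ps_sum mulr1.
by have := w_act i t it; lra.
Qed.

(** In a row that is never left, the reward equals the bound of
    [value_upper_bound] at every horizon.  Its average exceeds G only if no restart
    leads to the row, so that it matters as the initial one only. *)
Lemma value_never_active T h j m : (forall n, pass j n) ->
  value ps (threshold_policy R Gamma) rho T h (j, m.+1) =
  G * T%:R + excess f G j m (m + T).
Proof.
move=> pass_j; elim: T h m => [|T IHT] h m.
  by rewrite value0 mulr0 add0r addn0 /excess big_geq.
rewrite (valueS_deterministic _ _ _ (threshold_active Gamma)) // GammaE pass_j /=.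
rewrite rho_passive /next_mean /= IHT addnS addSn (excess_recl f G j m) ?ltnS ?leq_addr //.
by rewrite (max_idPl _) ?subr_ge0 ?pass_ge // -natr1; ring.
Qed.

(** The initial row decides: if the policy stays passive in it forever, it is
    optimal at each finite horizon; if not, both averages are compared with G. *)
Lemma threshold_optimal (w : 'I_K -> nat -> R) (B : R) :
  (forall N, surplus (ps 0) f R1 N G <= 0) ->
  (forall j m, w j m <= B) ->
  (forall j m, pass j m -> G + w j m <= f j m + w j m.+1) ->
  (forall j m, ~~ pass j m -> G + w j m <= R1 + \sum_k ps 0 k * w k 0%N) ->
  optimal P ps R1 R0 W (threshold_policy R Gamma).
Proof.
move=> surplus_le0 w_le w_pass w_act psi [j [//|m]] _; rewrite !gainE.
have average_le u v T : u <= v -> (((T%:R : R)^-1 * u)%:E <= (T%:R^-1 * v)%:E)%E.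
  by move=> uv; rewrite lee_fin ler_wpM2l // invr_ge0.
have [[n stop_n]|never] := pselect (exists n, ~~ pass j n); last first.
  apply: le_limn_einf => T; apply: average_le.
  rewrite value_never_active; first exact: value_upper_bound.
  by move=> n; apply: contrapT => /negP ?; apply: never; exists n.
apply: (@le_trans _ _ G%:E).
  rewrite -(limn_einf_affine_average G (excess f G j m (m + n))).
  apply: le_limn_einf => T; apply: average_le.
  apply: (le_trans (value_upper_bound _ surplus_le0 _ _ _ _ _)); rewrite lerD2l.
  have [Tn|/ltnW nT] := leqP T n.
    rewrite (excess_cat f G j m (m + T) (m + n)) ?leq_addr ?leq_add2l //.
    by rewrite lerDl excess_ge0.
  rewrite (excess_cat f G j m (m + n) (m + T)) ?leq_addr ?leq_add2l //.
  rewrite (excess_eq0 f f_nonincr G j (m + n)) ?addr0 //.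
  by rewrite (le_trans (f_nonincr j n (m + n) _)) ?leq_addl // pass_le.
rewrite -(limn_einf_affine_average G (w j m - B)).
apply: le_limn_einf => T; apply: average_le.
exact: value_lower_bound.
Qed.

End Threshold.

(** The potential is the remaining excess over G, computed up to the horizon N at
    which the cycle breaks even: F_N(G) = 0 is the Poisson equation at an active
    slot.  Beyond N the potential vanishes and passive slots still earn at
    least G. *)
Lemma optimal_threshold_balanced G N :
  (forall M, surplus (ps 0) f R1 M G <= 0) -> surplus (ps 0) f R1 N G = 0 ->
  exists Gamma : 'I_K -> option nat,
    optimal P ps R1 R0 W (threshold_policy R Gamma) /\
    (forall j, Gamma j = None -> forall m, G < f j m).
Proof.
move=> surplus_le0 balanced; pose pass j n := G < f j n.
have pass_down j m n : (m <= n)%N -> pass j n -> pass j m.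
  by move=> mn fn; apply: lt_le_trans fn _; exact: f_nonincr.
have [Gamma [GammaE GammaN]] := threshold_of_passive_set _ pass pass_down.
exists Gamma; split; last exact: GammaN.
pose w j m := excess f G j m N.
apply: (threshold_optimal G pass Gamma GammaE _ _ w
  (\sum_k excess f G k 0 N)) => //.
- by move=> j m /ltW.
- by move=> j m; rewrite -leNgt.
- move=> j m; rewrite (bigD1 j) //= -[w j m]addr0 lerD //; last first.
    by apply: sumr_ge0 => k _; exact: excess_ge0.
  have [mN|Nm] := leqP m N.
    by rewrite (excess_cat f G j 0 m N) // lerDr excess_ge0.
  by rewrite /w /excess big_geq ?(ltnW Nm) // excess_ge0.
- move=> j m pass_m; have [mN|Nm] := ltnP m N.
    rewrite /w excess_recl // (max_idPl _); first lra.
    by rewrite subr_ge0 ltW.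
  by rewrite /w /excess !big_geq ?(leqW Nm) // !addr0; exact: ltW.
- move=> j m; rewrite -leNgt => fm.
  rewrite /w (excess_eq0 f f_nonincr) // addr0.
  by move: balanced; rewrite /surplus; lra.
Qed.

(** The row k0 is absorbing under the policy and earns at least G there.  From any
    other row the expected number of restarts before entering it is at most
    1 / ps_k0 and each active slot loses G - R1, whence the constant potential -D
    outside k0. *)
Lemma optimal_threshold_absorbing G k0 :
  (forall M, surplus (ps 0) f R1 M G <= 0) ->
  0 < ps 0 k0 -> (forall n, G <= f k0 n) ->
  exists Gamma : 'I_K -> option nat,
    optimal P ps R1 R0 W (threshold_policy R Gamma) /\
    (forall j, Gamma j = None -> forall m, G <= f j m).
Proof.
move=> surplus_le0 pk0 fk0; pose pass j n := G <= f j n.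
have pass_down j m n : (m <= n)%N -> pass j n -> pass j m.
  by move=> mn fn; apply: le_trans fn _; exact: f_nonincr.
have [Gamma [GammaE GammaN]] := threshold_of_passive_set _ pass pass_down.
exists Gamma; split; last exact: GammaN.
have R1_leG : R1 <= G by have := surplus_le0 0%N; rewrite surplus0; lra.
pose D := (G - R1) / ps 0 k0.
have D_ge0 : 0 <= D by rewrite divr_ge0 // subr_ge0.
pose w (j : 'I_K) (m : nat) := if j == k0 then 0 else - D.
apply: (threshold_optimal G pass Gamma GammaE _ _ w 0) => //.
- by move=> j m; rewrite -ltNge => /ltW.
- by move=> j m; rewrite /w; case: ifP => // _; rewrite oppr_le0.
- by move=> j m; rewrite /w lerD2r.
move=> j m stop_m.
have -> : w j m = - D.
  by rewrite /w; case: eqP => // jk; move: stop_m; rewrite jk /pass fk0.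
have -> : \sum_k ps 0 k * w k 0%N = - D + ps 0 k0 * D.
  rewrite (bigD1 k0) //= /w eqxx mulr0 add0r.
  under eq_bigr => k /negPf-> do [].
  rewrite -mulr_suml.
  have -> : \sum_(k | k != k0) ps 0 k = 1 - ps 0 k0.
    by have := ps_sum; rewrite (bigD1 k0) //=; lra.
  ring.
have -> : ps 0 k0 * D = G - R1 by rewrite mulrC divfK ?gt_eqF.
lra.
Qed.

End Optimality.

Theorem theorem2 (R : realType) (K : nat) (P : 'M[R]_K) (ps : 'rV[R]_K)
    (R1 : R) (R0 : 'rV[R]_K -> R) (W : R)
    (P_stochastic : stochastic P)
    (ps_steady : steady_state P ps)
    (R0_ge0 : forall (j : 'I_K) (tau : nat), (1 <= tau)%N ->
       0 <= R0 (belief P j tau))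
    (max_prob_nonincr : forall (j : 'I_K) (tau tau' : nat),
       (1 <= tau)%N -> (tau <= tau')%N ->
       max_prob P j tau >= max_prob P j tau')
    (R0_nonincr : forall (j : 'I_K) (tau tau' : nat),
       (1 <= tau)%N -> (tau <= tau')%N ->
       R1 >= R0 (belief P j tau) /\
       R0 (belief P j tau) >= R0 (belief P j tau')) :
  exists Gamma : 'I_K -> option nat,
    optimal P ps R1 R0 W (threshold_policy R Gamma) /\
    (forall j : 'I_K, Gamma j = None ->
       forall tau : nat, (1 <= tau)%N -> R1 < W + R0 (belief P j tau)).
Proof.
have [ps_ge0 ps_sum _] := ps_steady.
pose f := passive_reward P R0 W.
have f_nonincr j m n : (m <= n)%N -> f j n <= f j m.
  by move=> mn; rewrite lerD2l; case: (R0_nonincr j m.+1 n.+1).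
have [G [surplus_le0 G_min]] :=
  critical_level_exists (ps 0) f R1 ps_ge0 ps_sum f_nonincr.
have R1_leG : R1 <= G by have := surplus_le0 0%N; rewrite surplus0; lra.
have [[N balanced]|unbalanced] := pselect (exists N, surplus (ps 0) f R1 N G = 0).
  have [Gamma [opt never]] := optimal_threshold_balanced P ps R1 R0 W
    ps_ge0 ps_sum f_nonincr G N surplus_le0 balanced.
  exists Gamma; split => // j /never Gj [//|n] _.
  exact: le_lt_trans R1_leG (Gj n).
have slack N : surplus (ps 0) f R1 N G < 0.
  rewrite lt_neqAle surplus_le0 andbT; apply/eqP => SN0.
  by apply: unbalanced; exists N.
have [k pk fk] :=
  critical_level_slack (ps 0) f R1 ps_ge0 ps_sum f_nonincr G slack G_min.
have [Gamma [opt never]] := optimal_threshold_absorbing P ps R1 R0 W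
  ps_ge0 ps_sum f_nonincr G k surplus_le0 pk fk.
have R1_ltG : R1 < G by have := slack 0%N; rewrite surplus0; lra.
exists Gamma; split => // j /never Gj [//|n] _.
exact: lt_le_trans (Gj n).
Qed.
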